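(* Let $G$ be a finitely generated virtually free group and let $K$ be a rational subset of $G$. Then $\mathrm{Geo}(\alpha(K))$ is context-free; that is, for every finite generating set $X$ of $G$ the language $\mathrm{Geo}_X(\alpha(K))$ is context-free, where $\alpha(K)=\bigcup_{u\in G}u^{-1}Ku$.
   Context: A group is virtually free if it has a free subgroup of finite index. For a finite generating set $X$ of $G$, let $\widetilde X=X\cup X^{-1}$ and let $\pi_X:\widetilde X^*\to G$ be the canonical surjective monoid homomorphism. A subset $K\subseteq G$ is rational if $K=L\pi_X$ for some rational (regular) language $L\subseteq\widetilde X^*$ (this does not depend on the finite generating set $X$). For $S\subseteq G$, $\mathrm{Geo}_X(S)\subseteq\widetilde X^*$ is the language of all geodesic words over $\widetilde X$ (words of minimal length among all words over $\widetilde X$ representing the same group element) that represent elements of $S$. The paper writes that $\mathrm{Geo}(S)$ is context-free to mean that $\mathrm{Geo}_X(S)$ is a context-free language for some (equivalently, for every) finite generating set $X$. *)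

(* Defs.v *)
From Stdlib Require Export Relation_Operators.
From HB Require Export structures.
From mathcomp Require Export all_boot finmap.
From mathcomp Require Export boolp classical_sets functions cardinality.

Set Implicit Arguments.
Unset Strict Implicit.
Unset Printing Implicit Defensive.

Local Open Scope group_scope.
Local Open Scope classical_set_scope.

Record nfa (A : finType) := NFA {
  nfa_state : finType;
  nfa_init : {set nfa_state};
  nfa_final : {set nfa_state};
  nfa_trans : nfa_state -> A -> nfa_state -> bool
}.

Fixpoint nfa_accept_from (A : finType) (M : nfa A) (q : nfa_state M)
    (w : seq A) : Prop :=
  match w with
  | [::] => q \in nfa_final M
  | a :: w' => exists2 q', nfa_trans q a q' & nfa_accept_from q' w'
  end.

Definition nfa_lang (A : finType) (M : nfa A) : set (seq A) :=
  [set w | exists2 q, q \in nfa_init M & nfa_accept_from q w].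

Definition regular (A : finType) (L : set (seq A)) : Prop :=
  exists M : nfa A, L = nfa_lang M.

(* Sentential forms are words over [cfg_var + A]: [inl] for variables, [inr] for
   terminals. *)
Record cfg (A : finType) := CFG {
  cfg_var : finType;
  cfg_start : cfg_var;
  cfg_rules : seq (cfg_var * seq (cfg_var + A))
}.

Inductive cfg_step (A : finType) (g : cfg A) :
    seq (cfg_var g + A) -> seq (cfg_var g + A) -> Prop :=
  CfgStep u v V r of (V, r) \in cfg_rules g :
    cfg_step (u ++ inl V :: v) (u ++ r ++ v).

Definition cfg_derives (A : finType) (g : cfg A) :
    seq (cfg_var g + A) -> seq (cfg_var g + A) -> Prop :=
  clos_refl_trans _ (@cfg_step A g).

Definition cfg_lang (A : finType) (g : cfg A) : set (seq A) :=
  [set w | cfg_derives [:: inl (cfg_start g)] (map inr w)].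

Definition context_free (A : finType) (L : set (seq A)) : Prop :=
  exists g : cfg A, L = cfg_lang g.

(* Here X^-1 is the set of inverses in G, not a set of formal inverses: the
   alphabet is a finite subset of G, seen as a finType. *)
Definition symm (G : groupType) (X : {fset G}) : {fset G} :=
  (X `|` [fset x^-1 | x in X])%fset.

Definition word (G : groupType) (X : {fset G}) := seq (symm X).

Definition word_val (G : groupType) (X : {fset G}) (w : word X) : G :=
  \prod_(a <- w) val a.

Definition generates (G : groupType) (X : {fset G}) : Prop :=
  forall g : G, exists w : word X, word_val w = g.

Definition finitely_generated (G : groupType) : Prop :=
  exists X : {fset G}, generates X.

Definition geodesic (G : groupType) (X : {fset G}) (w : word X) : Prop :=
  forall w' : word X, word_val w' = word_val w -> size w <= size w'.

Definition Geo (G : groupType) (X : {fset G}) (S : set G) : set (word X) :=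
  [set w | geodesic w /\ S (word_val w)].

Definition rational (G : groupType) (K : set G) : Prop :=
  exists X : {fset G}, generates X /\
  exists L : set (word X), regular L /\ K = @word_val G X @` L.

Definition subgroup (G : groupType) (H : set G) : Prop :=
  H 1 /\ (forall x y, H x -> H y -> H (x / y)).

Definition finite_index (G : groupType) (H : set G) : Prop :=
  finite_set (range (fun g : G => [set h * g | h in H])).

(* A letter [(b, false)] stands for b, and [(b, true)] for its formal inverse. *)
Definition fletter_val (G : groupType) (a : G * bool) : G :=
  if a.2 then a.1^-1 else a.1.

Definition fword_val (G : groupType) (w : seq (G * bool)) : G :=
  \prod_(a <- w) fletter_val a.

Definition cancelling (G : groupType) (a b : G * bool) : bool :=
  (a.1 == b.1) && (a.2 != b.2).

Definition reduced_words (G : groupType) (B : set G) : set (seq (G * bool)) :=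
  [set w | (forall a, a \in w -> B a.1) /\
           sorted (fun a b => ~~ cancelling a b) w].

(* The subgroup H is free on B: each element of H is represented by exactly one
   freely reduced word over B, and every such word represents an element of H. *)
Definition free_on (G : groupType) (B H : set G) : Prop :=
  set_bij (reduced_words B) H (@fword_val G).

Definition free_subgroup (G : groupType) (H : set G) : Prop :=
  subgroup H /\ exists B : set G, free_on B H.

Definition virtually_free (G : groupType) : Prop :=
  exists H : set G, free_subgroup H /\ finite_index H.

Definition conj_closure (G : groupType) (K : set G) : set G :=
  \bigcup_(u in [set: G]) [set u^-1 * k * u | k in K].

(* Main.v *)
Require Import Defs.

(** Write [alpha K] for the union of the conjugates of [K].

    Reduced words in a free group form a tree, so a closed path in the Cayley
    graph of a virtually free group can be triangulated by chords of bounded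
    length. Cutting such a triangulated polygon along its central triangle gives
    everything else.

    Geodesics sharing their origin and ending at adjacent points fellow-travel,
    so the geodesic words form a regular language, and it is enough to find a
    context-free language between [Geo (alpha K)] and [alpha K].

    For the latter take as nonterminals the conditions "[w] has value [a]",
    "[w f] lies in [alpha K]", and "[w = x l y^-1] for a label [l] of a run from
    [s] to [t]", where [a], [f], [x], [y] are short, and as rules all sound
    binary rules. If [w] lies in [alpha K], choose a shortest [u] such that
    [w u = u l] with [l] in [K], and triangulate the polygon [w u l^-1 u^-1]:
    either [w] has a rotation [w2 w1 = x l' x^-1], with [x] short and [l'] a
    rotation of [l], or, by minimality of [u], it has a short rotation. In both
    cases [w = c v b] with [f = b c] short and [v f] close to a run of the
    automaton or trivial, and a triangulation of [b c] lets the rules peel [w]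
    down to [v]. *)

Set Implicit Arguments.
Unset Strict Implicit.
Unset Printing Implicit Defensive.

Local Open Scope group_scope.
Local Open Scope classical_set_scope.

(** * Grammars of sound binary rules *)

Section Grammar.
Variables (A I : finType) (sem : I -> set (seq A)).

(** Membership is described by parse trees whose nodes are sound rules. Soundness is then immediate,
    and a concrete choice of [sem] only calls for completeness. *)
Inductive gen : I -> seq A -> Prop :=
| gen_nil i of sem i [::] : gen i [::]
| gen_letter i a of sem i [:: a] : gen i [:: a]
| gen_cat i j k u v of (forall u v, sem j u -> sem k v -> sem i (u ++ v))
    & gen j u & gen k v : gen i (u ++ v).

Lemma gen_sound i w : gen i w -> sem i w.
Proof. by elim=> // {}i j k u v H _ Hj _ Hk; apply: H. Qed.

Variable start : pred I.

(** [None] is a fresh start symbol, which allows several starting conditions. *)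
Definition gen_var : finType := option I.

Definition gen_rules : seq (gen_var * seq (gen_var + A)) :=
  [seq (None, [:: inl (Some i)]) | i <- enum start] ++
  [seq (Some i, [::]) | i <- [seq i <- enum I | `[< sem i [::] >]]] ++
  [seq (Some p.1, [:: inr p.2]) |
     p <- [seq p <- enum {: I * A} | `[< sem p.1 [:: p.2] >]]] ++
  [seq (Some p.1.1, [:: inl (Some p.1.2); inl (Some p.2)]) |
     p <- [seq p <- enum {: I * I * I} |
           `[< forall u v, sem p.1.2 u -> sem p.2 v ->
               sem p.1.1 (u ++ v) >]]].

Definition gen_cfg : cfg A := CFG None gen_rules.

Lemma gen_rulesP V r : (V, r) \in gen_rules <->
  [\/ exists2 i, start i & (V, r) = (None, [:: inl (Some i)]),
      exists2 i, sem i [::] & (V, r) = (Some i, [::]),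
      exists i a, sem i [:: a] /\ (V, r) = (Some i, [:: inr a]) |
      exists i j k, (forall u v, sem j u -> sem k v -> sem i (u ++ v)) /\
        (V, r) = (Some i, [:: inl (Some j); inl (Some k)])].
Proof.
rewrite !mem_cat; split.
  case/or4P=> /mapP[x]; rewrite ?mem_enum ?mem_filter.
  - by move=> sx ->; constructor 1; exists x.
  - by move=> /andP[/asboolP ? _] ->; constructor 2; exists x.
  - move=> /andP[/asboolP ? _] ->; constructor 3; by exists x.1, x.2.
  - move=> /andP[/asboolP ? _] ->; constructor 4; by exists x.1.1, x.1.2, x.2.
case=> [[i si ->]|[i si ->]|[i [a [si ->]]]|[i [j [k [si ->]]]]]; apply/or4P.
- by constructor 1; apply/mapP; exists i; rewrite ?mem_enum.
- constructor 2; apply/mapP; exists i => //.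
  by rewrite mem_filter mem_enum andbT; apply/asboolP.
- constructor 3; apply/mapP; exists (i, a) => //.
  by rewrite mem_filter mem_enum andbT; apply/asboolP.
- constructor 4; apply/mapP; exists (i, j, k) => //.
  by rewrite mem_filter mem_enum andbT; apply/asboolP.
Qed.

Lemma cfg_derives_ctx u v f f' : cfg_derives (g := gen_cfg) f f' ->
  cfg_derives (g := gen_cfg) (u ++ f ++ v) (u ++ f' ++ v).
Proof.
elim=> {f f'} [f f' [l r V s VS]|f|f1 f2 f3 _ H1 _ H2].
- apply: rt_step; rewrite -!catA /= !(catA u).
  exact: (CfgStep _ _ VS).
- exact: rt_refl.
- exact: rt_trans H1 H2.
Qed.

Lemma cfg_derives_rule V r : (V, r) \in gen_rules ->
  cfg_derives (g := gen_cfg) [:: inl V] r.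
Proof.
by move=> Vr; apply: rt_step; have := @CfgStep _ gen_cfg [::] [::] V r Vr;
   rewrite /= cats0.
Qed.

Lemma gen_derives i w : gen i w ->
  cfg_derives (g := gen_cfg) [:: inl (Some i)] (map inr w).
Proof.
elim=> {i w} [i si|i a si|i j k u v H _ IHj _ IHk].
- by apply: cfg_derives_rule; apply/gen_rulesP; constructor 2; exists i.
- by apply: cfg_derives_rule; apply/gen_rulesP; constructor 3; exists i, a.
apply: (rt_trans _ _ _ [:: inl (Some j); inl (Some k)]).
  by apply: cfg_derives_rule; apply/gen_rulesP; constructor 4; exists i, j, k.
apply: (rt_trans _ _ _ (map inr u ++ [:: inl (Some k)])).
  exact: (cfg_derives_ctx [::] [:: inl (Some k)] IHj).
have := cfg_derives_ctx (map inr u) [::] IHk.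
by rewrite !cats0 map_cat.
Qed.

Definition var_gen (V : gen_var) (w : seq A) : Prop :=
  if V is Some i then gen i w else exists2 i, start i & gen i w.

(** Sentential forms are read with [gen] at the variables. This reading pulls back along derivation
    steps, so a derivation of a word yields a parse tree. *)
Fixpoint form_gen (f : seq (gen_var + A)) (w : seq A) : Prop :=
  match f with
  | [::] => w = [::]
  | inr a :: f' => exists2 w', w = a :: w' & form_gen f' w'
  | inl V :: f' => exists u w', [/\ w = u ++ w', var_gen V u & form_gen f' w']
  end.

Lemma form_gen_cat f f' w : form_gen (f ++ f') w <->
  exists u v, [/\ w = u ++ v, form_gen f u & form_gen f' v].
Proof.
elim: f w => [|[V|a] f IH] w /=.
- by split=> [fw|[u [v [-> -> //]]]]; exists [::], w.
- split=> [[u [w' [-> Vu /IH[u' [v [-> fu' fv]]]]]]|].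
    by exists (u ++ u'), v; rewrite catA; split=> //; exists u, u'.
  move=> [u [v [-> [u1 [u2 [-> V1 f2]]] fv]]].
  by exists u1, (u2 ++ v); rewrite catA; split=> //; apply/IH; exists u2, v.
- split=> [[w' -> /IH[u [v [-> fu fv]]]]|[u [v [-> [u' -> fu] fv]]]].
    by exists (a :: u), v; split=> //; exists u.
  by exists (u' ++ v) => //; apply/IH; exists u', v.
Qed.

Lemma form_gen_rule V r w : (V, r) \in gen_rules -> form_gen r w -> var_gen V w.
Proof.
move=> /gen_rulesP[[i si [-> ->]]|[i si [-> ->]]|[i [a [si [-> ->]]]]|
  [i [j [k [H [-> ->]]]]]] /=.
- by move=> [u [w' [-> iu ->]]]; exists i; rewrite ?cats0.
- by move=> ->; apply: gen_nil.
- by move=> [w' -> ->]; apply: gen_letter.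
- move=> [u [w' [-> ju [v [w'' [-> kv ->]]]]]]; rewrite cats0.
  exact: gen_cat H ju kv.
Qed.

Lemma form_gen_step f f' w : cfg_step (g := gen_cfg) f f' ->
  form_gen f' w -> form_gen f w.
Proof.
case=> u v V r Vr /form_gen_cat[x [y [-> ux]]].
move=> /form_gen_cat[y1 [y2 [-> ry vy]]].
apply/form_gen_cat; exists x, (y1 ++ y2); split=> //=.
by exists y1, y2; split=> //; apply: form_gen_rule Vr ry.
Qed.

Lemma form_gen_derives f f' w : cfg_derives (g := gen_cfg) f f' ->
  form_gen f' w -> form_gen f w.
Proof.
elim=> {f f'} // [f f'|f1 f2 f3 _ H1 _ H2]; first exact: form_gen_step.
by move/H2/H1.
Qed.

Lemma form_gen_map w : form_gen (map inr w) w.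
Proof. by elim: w => //= a w IH; exists w. Qed.

Lemma context_free_gen : context_free [set w | exists2 i, start i & gen i w].
Proof.
exists gen_cfg; apply/seteqP; split=> w /=.
  move=> [i si iw]; apply: rt_trans (gen_derives iw).
  by apply: cfg_derives_rule; apply/gen_rulesP; constructor 1; exists i.
rewrite /cfg_lang /= => /form_gen_derives/(_ (form_gen_map w)) /=.
move=> [u [w' [-> Vu ->]]].
by rewrite cats0.
Qed.

End Grammar.

(** * Intersection with a regular language *)

Section Product.
Variables (A I Q : finType) (sem : I -> set (seq A)) (delta : Q -> A -> Q).

(** The triple construction: a condition is annotated with the states before and after reading the
    word, and a sound rule stays sound when these states match up. *)
Definition sem_dfa (x : I * Q * Q) : set (seq A) :=
  [set w | sem x.1.1 w /\ foldl delta x.1.2 w = x.2].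

Lemma gen_dfa i w p : gen sem i w -> gen sem_dfa (i, p, foldl delta p w) w.
Proof.
move=> iw; elim: iw p => {i w} [i si|i a si|i j k u v H _ IHj _ IHk] p.
- exact: gen_nil.
- exact: gen_letter.
rewrite foldl_cat; apply: gen_cat (IHj p) (IHk (foldl delta p u)).
move=> u' v' [/= ju' pu'] [/= kv' pv'].
by split; [apply: H|rewrite /= foldl_cat pu' pv'].
Qed.

(** The grammar may generate less than [sem i]: it is enough that it generates all of [L], since the
    automaton cuts [sem i] down to [L]. *)
Lemma context_free_dfa (i : I) (q0 : Q) (F : pred Q) (L : set (seq A)) :
  (forall w, L w <-> sem i w /\ F (foldl delta q0 w)) ->
  (forall w, L w -> gen sem i w) -> context_free L.
Proof.
move=> LE Lgen.
suff -> : L = [set w | exists2 x, [pred x | (x.1 == (i, q0)) && F x.2] x &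
    gen sem_dfa x w].
  exact: context_free_gen.
apply/seteqP; split=> w /= => [Lw|].
  exists (i, q0, foldl delta q0 w); last exact/gen_dfa/Lgen.
  by rewrite /= eqxx /=; apply LE.
move=> [[[j p] q] /= /andP[/eqP[-> ->] Fq]] /gen_sound[/= jw qE].
by apply/LE; rewrite qE.
Qed.

End Product.

(** * Triangulated polygons *)

Lemma cat_eq_cat (T : Type) (u v p q : seq T) : u ++ v = p ++ q ->
  (exists m, u = p ++ m /\ q = m ++ v) \/ (exists m, p = u ++ m /\ v = m ++ q).
Proof.
elim: u p => [|a u IH] [|b p] /=.
- by move=> ->; left; exists [::].
- by move=> ->; right; exists (b :: p).
- by move=> <-; left; exists (a :: u).
by case=> -> /IH[[m [-> ->]]|[m [-> ->]]]; [left|right]; exists m.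
Qed.

Ltac gsimp := rewrite ?(invgM, invgK, =^~ mulgA, mulKg, mulVKg, mulgV, mulVg,
  mulg1, mul1g, invg1).

Section Triangulation.
Variable G : groupType.

Definition gprod (s : seq G) : G := \prod_(x <- s) x.

Lemma gprod_nil : gprod [::] = 1. Proof. exact: big_nil. Qed.

Lemma gprod_cons x s : gprod (x :: s) = x * gprod s.
Proof. exact: big_cons. Qed.

Lemma gprod_cat s t : gprod (s ++ t) = gprod s * gprod t.
Proof. exact: big_cat. Qed.

Lemma gprod1 x : gprod [:: x] = x. Proof. exact: big_seq1. Qed.

Definition ginv (s : seq G) : seq G := [seq x^-1 | x <- rev s].

Lemma ginv_cat s t : ginv (s ++ t) = ginv t ++ ginv s.
Proof. by rewrite /ginv rev_cat map_cat. Qed.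

Lemma ginvK s : ginv (ginv s) = s.
Proof.
by rewrite /ginv -map_rev revK -map_comp -[RHS]map_id; apply: eq_map => x;
   apply: invgK.
Qed.

Lemma gprod_ginv s : gprod (ginv s) = (gprod s)^-1.
Proof.
by rewrite /gprod big_map prodgV revK.
Qed.

(* A sequence of steps, read as a path, together with the edge joining its ends
   is a polygon; [tri F] says that it can be triangulated by chords in [F]. *)
Inductive tri (F : set G) : seq G -> Prop :=
| tri1 x of F x : tri F [:: x]
| tri_cat s t of tri F s & tri F t & F (gprod (s ++ t)) : tri F (s ++ t).

Lemma tri_gprod F s : tri F s -> F (gprod s).
Proof. by case=> // x Fx; rewrite gprod1. Qed.

(** The edge [x * y] is a leaf of the triangulation; the triangle with sides [x], [y] and [x * y] is
    glued onto it. *)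
Lemma tri_refine F s p q x y : tri F s -> s = p ++ x * y :: q ->
  F x -> F y -> tri F (p ++ [:: x, y & q]).
Proof.
move=> ts sE Fx Fy; elim: ts p q sE => {s} [z Fz|s t ts IHs tt IHt Fst] p q.
  case: p => [|a p] /= [zE]; last by case: p.
  move=> <-; apply: (tri_cat (tri1 Fx) (tri1 Fy)).
  by rewrite /= gprod_cons gprod1 -zE.
have stE : gprod (p ++ [:: x, y & q]) = gprod (p ++ x * y :: q).
  by rewrite !gprod_cat !gprod_cons -!mulgA.
move=> E; have Fpq : F (gprod (p ++ [:: x, y & q])) by rewrite stE -E.
case/cat_eq_cat: E Fpq => [[[|c m] [sE qE]]|[m [pE tE]]].
- rewrite cats0 in sE; rewrite -sE => Fpq.
  by apply: tri_cat => //; apply: (IHt [::]); rewrite qE.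
- case: qE => cE qE; rewrite qE -/([:: x, y & m] ++ t).
  rewrite -[in X in tri _ X]/([:: x, y & m] ++ t) catA => Fpq.
  by apply: tri_cat => //; apply: IHs; rewrite sE cE.
- by rewrite pE -catA => Fpq; apply: tri_cat => //; apply: IHt.
Qed.

(* The triangle separating the three sides [s1], [s2], [s3] from each other. *)
Lemma tri_center F s1 s2 s3 : F 1 -> tri F (s1 ++ s2 ++ s3) ->
  exists a b c d e f, [/\ s1 = a ++ b, s2 = c ++ d, s3 = e ++ f,
    F (gprod (b ++ c)) & F (gprod (d ++ e))].
Proof.
move=> F1; move E: (s1 ++ _) => s ts.
elim: ts s1 s2 s3 E => {s} [x Fx|s t ts IHs tt IHt Fst] s1 s2 s3.
  case: s1 => [|y s1] /=; last first.
    case=> ->; case: s1 => //; case: s2 => //; case: s3 => // _.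
    by exists [:: x], [::], [::], [::], [::], [::]; rewrite gprod_nil.
  case: s2 => [|y s2] /= E.
    exists [::], [::], [::], [::], s3, [::].
    by rewrite cats0 /= gprod_nil E gprod1.
  case: s2 E => [|//]; case: s3 => // -[->].
  exists [::], [::], [::], [:: x], [::], [::].
  by rewrite gprod_nil gprod1.
(* If the division between [s] and [t] falls in [s1] or [s3], the outer piece joins [a] or [f] and
   the induction continues on the other piece. *)
move/esym/cat_eq_cat => [[m [sE mE]]|[m [s1E tE]]]; last first.
  case: (IHt _ _ _ (esym tE)) => [a [b [c [d [e [f [mE -> -> bc de]]]]]]].
  by exists (s ++ a), b, c, d, e, f; rewrite s1E mE -catA.
case/esym/cat_eq_cat: mE => [[m' [mE s3E]]|[m' [s2E tE]]].
  rewrite mE in sE.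
  case: (IHs _ _ _ (esym sE)) => [a [b [c [d [e [f [-> -> m'E bc de]]]]]]].
  by exists a, b, c, d, e, (f ++ t); rewrite catA -m'E.
(* The division falls in [s2], and the root triangle is the central one. *)
exists [::], s1, m, m', s3, [::]; rewrite cats0; split=> //.
  by rewrite -sE; apply: tri_gprod.
by rewrite -tE; apply: tri_gprod.
Qed.

(** * Cutting ears off a closed path *)

Section Ear.
Variables (V : eqType) (E : rel V) (ht : V -> nat) (g : V -> G) (F : set G).
Hypothesis Esym : symmetric E.
(** This is where the tree enters: at a highest vertex of a closed path, the two neighbours on the
    path are joined by a chord. The height will be the length of a reduced word. *)
Hypothesis Eear : forall v a b, ht a <= ht v -> ht b <= ht v ->
  E a v -> E v b -> E a b.
Hypothesis EF : forall a b, E a b -> F ((g a)^-1 * g b).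

Let step a b := (g a)^-1 * g b.

Lemma gprod_pairmap v s : gprod (pairmap step v s) = (g v)^-1 * g (last v s).
Proof.
elim: s v => [|a s IH] v /=; first by rewrite gprod_nil mulVg.
by rewrite gprod_cons IH /step; gsimp.
Qed.

Lemma exists_highest v s : exists s1 x s2, v :: s = s1 ++ x :: s2 /\
  {in v :: s, forall y, ht y <= ht x}.
Proof.
elim: s v => [|a s IH] v.
  by exists [::], v, [::]; split=> // y; rewrite mem_seq1 => /eqP->.
have [s1 [x [s2 [sE mx]]]] := IH a.
have [xv|vx] := leqP (ht x) (ht v).
  exists [::], v, (a :: s); split=> // y.
  by rewrite inE => /predU1P[->//|/mx yx]; exact: leq_trans yx xv.
exists (v :: s1), x, s2; rewrite sE; split=> // y.
by rewrite inE -sE => /predU1P[->|/mx//]; exact: ltnW.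
Qed.

(* Cut off the ear at a highest vertex. *)
Lemma tri_ear v s : path E v s -> E v (last v s) -> s <> [::] ->
  tri F (pairmap step v s).
Proof.
have [n] := ubnP (size s); elim: n v s => // n IH v s sn vs vl s0.
have [s1 [x [s2 [sE mx]]]] := exists_highest v s.
have tri_single a b : E a b -> tri F [:: step a b] by move=> ?; apply/tri1/EF.
have Fvs := EF vl; rewrite -gprod_pairmap in Fvs.
(* The highest vertex is the first, the last or an inner one; in the first two cases the ear
   contains the closing edge. *)
case: s1 sE => [[? ?]|v' s1 [? sE]]; [subst x s2|subst v' s].
  case: s sn vs vl s0 mx Fvs => [//|b [|c s]] sn vs vl _ mx Fvs.
    by apply: tri_single; case/andP: vs.
  case/andP: vs => vb bs.
  apply: (@tri_cat _ [:: step v b] (pairmap step b (c :: s)));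
    [exact: tri_single| |exact: Fvs].
  apply: IH => //; apply: (@Eear v) => //; last by rewrite Esym.
    by apply: mx; rewrite !inE eqxx orbT.
  by apply: mx; rewrite inE mem_last orbT.
case: s2 sn vs vl mx s0 Fvs => [|b s2] sn vs vl mx _ Fvs.
  move: sn vs vl mx Fvs; rewrite cats1 size_rcons rcons_path last_rcons.
  rewrite -cats1 pairmap_cat /= => sn /andP[vs lx] vx mx Fvs.
  case: s1 sn vs lx mx Fvs => [|c s1] sn vs lx mx Fvs; first exact: tri_single.
  apply: tri_cat; [|exact: tri_single|exact: Fvs].
  apply: IH => //; apply: (@Eear x) => //; last by rewrite Esym.
    by apply: mx; rewrite inE eqxx.
  by apply: mx; rewrite -cat_cons mem_cat mem_last.
(* The two edges at [x] are replaced by a chord, and [tri_refine] puts the ear back. *)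
rewrite pairmap_cat /=; apply: (tri_refine _ erefl).
- have -> : step (last v s1) x * step x b = step (last v s1) b.
    by rewrite /step; gsimp.
  rewrite -/(pairmap step (last v s1) (b :: s2)) -pairmap_cat.
  move: vs vl sn; rewrite !cat_path /= !last_cat /= !size_cat /= !addnS.
  move=> /and4P[vs1 lx xb bs2] vl sn; apply: IH; last by case: (s1).
  + by rewrite size_cat /= addnS.
  + rewrite cat_path vs1 /= bs2 andbT; apply: (@Eear x) => //.
      by apply: mx; rewrite -cat_cons mem_cat mem_last.
    by apply: mx; rewrite -cat_cons mem_cat !inE eqxx !orbT.
  + by rewrite last_cat.
- by apply: EF; move: vs; rewrite cat_path /= => /and4P[].
- by apply: EF; move: vs; rewrite cat_path /= => /and4P[].
Qed.

End Ear.

End Triangulation.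

(** * Balls and reduced words *)

Section Ball.
Variables (G : groupType) (X : {fset G}).
Implicit Types (w : word X) (n m : nat) (x y : G).

Definition steps w : seq G := map val w.

Lemma gprod_steps w : gprod (steps w) = word_val w.
Proof. exact: big_map. Qed.

Lemma word_val_cat w w' : word_val (w ++ w') = word_val w * word_val w'.
Proof. exact: big_cat. Qed.

Lemma word_val_nil : word_val ([::] : word X) = 1.
Proof. exact: big_nil. Qed.

Definition ball n : set G :=
  [set x | exists2 w : word X, size w <= n & word_val w = x].

Lemma ball_sub n m : n <= m -> ball n `<=` ball m.
Proof. by move=> nm x [w wn wx]; exists w => //; apply: leq_trans nm. Qed.

Lemma ball_word w : ball (size w) (word_val w).
Proof. by exists w. Qed.

Lemma ball1 n : ball n 1.
Proof. by exists [::]; rewrite ?word_val_nil. Qed.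

Lemma ball_mul n m x y : ball n x -> ball m y -> ball (n + m) (x * y).
Proof.
move=> [w wn <-] [w' wm <-]; exists (w ++ w'); last exact: word_val_cat.
by rewrite size_cat leq_add.
Qed.

Lemma symm_inv (a : symm X) : exists b : symm X, val b = (val a)^-1.
Proof.
suff aX : (val a)^-1 \in symm X by exists [` aX]%fset.
have := valP a; rewrite !in_fsetU => /orP[aX|/imfsetP[/= x xX ->]].
  by apply/orP; right; apply/imfsetP; exists (val a).
by rewrite invgK xX.
Qed.

Lemma word_inv w : exists2 w', size w' = size w & steps w' = ginv (steps w).
Proof.
elim: w => [|a w [w' sw' wE]]; first by exists [::].
have [b bE] := symm_inv a.
exists (rcons w' b); first by rewrite size_rcons sw'.
by rewrite /steps map_rcons -/(steps w') wE bE /ginv /= rev_cons map_rcons.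
Qed.

Lemma ball_inv n x : ball n x -> ball n x^-1.
Proof.
move=> [w wn <-]; have [w' sw' wE] := word_inv w.
exists w'; first by rewrite sw'.
by rewrite -!gprod_steps wE gprod_ginv.
Qed.

Lemma ball_letter (a : symm X) n : 0 < n -> ball n (val a).
Proof. by exists [:: a] => //; rewrite /word_val big_seq1. Qed.

Lemma ball_steps w n : 0 < n -> {in steps w, forall x, ball n x}.
Proof. by move=> n0 x /mapP[a _ ->]; apply: ball_letter. Qed.

Lemma ball_ginv (s : seq G) n : {in s, forall x, ball n x} ->
  {in ginv s, forall x, ball n x}.
Proof.
by move=> sn x /mapP[y ys ->]; apply/ball_inv/sn; rewrite mem_rev in ys.
Qed.

Lemma finite_ball n : finite_set (ball n).
Proof.
apply: (@sub_finite_set _ _ (range (fun w : n.-bseq (symm X) => word_val w))).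
  by move=> x [w wn <-]; exists (Bseq wn).
exact/finite_image/finite_finset.
Qed.

Hypothesis Xgen : generates X.

Lemma finite_sub_ball (S : set G) : finite_set S -> exists n, S `<=` ball n.
Proof.
move=> /finite_seqP[s ->]; elim: s => [|x s [n IH]]; first by exists 0.
have [w wx] := Xgen x; exists (maxn (size w) n) => y /=; rewrite inE.
case/predU1P => [->|/IH]; last exact/ball_sub/leq_maxr.
by rewrite -wx; apply: ball_sub (ball_word w); apply: leq_maxl.
Qed.

End Ball.

(** * Freely reduced words as stacks *)

Section Stack.
Variable G : groupType.
Implicit Types (a b : G * bool) (r w : seq (G * bool)).

(* Freely reduced words are stored with their last letter on top. *)
Definition stack_val r : G := fword_val (rev r).

Lemma fword_val_cat w w' : fword_val (w ++ w') = fword_val w * fword_val w'.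
Proof. exact: big_cat. Qed.

Lemma stack_val_cat r r' : stack_val (r ++ r') = stack_val r' * stack_val r.
Proof. by rewrite /stack_val rev_cat fword_val_cat. Qed.

Lemma stack_val_cons a r : stack_val (a :: r) = stack_val r * fletter_val a.
Proof. by rewrite -cat1s stack_val_cat; congr (_ * _); apply: big_seq1. Qed.

Lemma stack_val_nil : stack_val [::] = 1. Proof. exact: big_nil. Qed.

Lemma cancellingC a b : cancelling a b = cancelling b a.
Proof. by rewrite /cancelling eq_sym (eq_sym a.2). Qed.

Definition reduced r := sorted (fun a b => ~~ cancelling a b) r.

Lemma reduced_rev r : reduced (rev r) = reduced r.
Proof.
rewrite /reduced rev_sorted; case: r => //= a r; apply: eq_path => x y.
by rewrite cancellingC.
Qed.

Definition push r a :=
  if r is b :: r' then if cancelling b a then r' else a :: r else [:: a].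

Lemma stack_val_push r a : stack_val (push r a) = stack_val r * fletter_val a.
Proof.
case: r => [|b r] /=; first exact: stack_val_cons.
case: ifP => [/andP[/eqP ab1 ab2]|_]; last exact: stack_val_cons.
rewrite stack_val_cons -mulgA; suff -> : fletter_val b * fletter_val a = 1.
  by rewrite mulg1.
case: a b ab1 ab2 => [x e] [y f] /= -> ; rewrite /fletter_val.
by case: e f => [] [] //= _; rewrite ?mulgV ?mulVg.
Qed.

Lemma reduced_push r a : reduced r -> reduced (push r a).
Proof.
case: r => [|b r] //= br; case: ifP => [_|ba]; first exact: path_sorted br.
by rewrite /= br cancellingC ba.
Qed.

Lemma all_push (p : pred (G * bool)) r a : all p r -> p a -> all p (push r a).
Proof.
case: r => [|b r] /= pr pa; first by rewrite pa.
by case: ifP => _; [case/andP: pr|rewrite /= pa].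
Qed.

(** The bottom [p] is a common ancestor in the tree of reduced words. Bounding the two branches
    separately lets [near_ear] keep the same [D]. *)
Definition near D r r' := exists x y p,
  [/\ r = x ++ p, r' = y ++ p, size x <= D & size y <= D].

Lemma near_sym D r r' : near D r r' -> near D r' r.
Proof. by move=> [x [y [p [-> -> xD yD]]]]; exists y, x, p. Qed.

(** A pop that reaches into the common part [p] lengthens the branch [x] by one letter; any other
    push affects only the branch [y]. *)
Lemma near_push D r r' a : near D r r' -> near D.+1 r (push r' a).
Proof.
move=> [x [y [p [-> -> xD yD]]]]; case: y yD => [|b y] yD /=.
  case: p => [|b p] /=.
    by exists x, [:: a], [::]; split=> //; apply: leqW.
  case: ifP => _; last by exists x, [:: a], (b :: p); split=> //; apply: leqW.
  exists (rcons x b), [::], p; split=> //; last by rewrite size_rcons.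
  by rewrite -cats1 -catA.
case: ifP => _; last by exists x, [:: a, b & y], p; split=> //; apply: leqW.
exists x, y, p; split=> //; first exact: leqW.
exact/leqW/ltnW.
Qed.

Lemma near_pushes r w : near (size w) r (foldl push r w).
Proof.
elim/last_ind: w => [|w a IH] /=; first by exists [::], [::], r.
by rewrite foldl_rcons size_rcons; apply: near_push.
Qed.

Lemma near_leq D D' r r' : D <= D' -> near D r r' -> near D' r r'.
Proof.
move=> DD' [x [y [p [-> -> xD yD]]]]; exists x, y, p; split=> //;
  exact: leq_trans DD'.
Qed.

(* Both common parts are prefixes of the longest of the three words. *)
Lemma near_ear D v r r' : size r <= size v -> size r' <= size v ->
  near D r v -> near D v r' -> near D r r'.
Proof.
move=> rv r'v [x [y [p [rE vE xD yD]]]] [y' [x' [p' [vE' rE' yD' xD']]]].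
have xy : size x <= size y by move: rv; rewrite rE vE !size_cat leq_add2r.
have xy' : size x' <= size y' by move: r'v; rewrite rE' vE' !size_cat leq_add2r.
move: vE'; rewrite vE => /cat_eq_cat[[m [yE p'E]]|[m [yE p'E]]].
  exists x, (x' ++ m), p; rewrite rE rE' p'E -catA; split=> //.
  by apply: leq_trans yD; rewrite yE !size_cat leq_add2r.
exists (x ++ m), x', p'; rewrite rE rE' p'E -catA; split=> //.
by apply: leq_trans yD'; rewrite yE !size_cat leq_add2r.
Qed.

Lemma stack_val_pushes r w :
  stack_val (foldl push r w) = stack_val r * fword_val w.
Proof.
elim/last_ind: w => [|w a IH] /=; first by rewrite [fword_val _]big_nil mulg1.
rewrite foldl_rcons stack_val_push IH -mulgA; congr (_ * _).
by rewrite -cats1 fword_val_cat; congr (_ * _); rewrite [RHS]big_seq1.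
Qed.

Lemma reduced_pushes r w : reduced r -> reduced (foldl push r w).
Proof. by elim: w r => //= a w IH r rr; apply/IH/reduced_push. Qed.

Lemma all_pushes (p : pred (G * bool)) r w :
  all p r -> all p w -> all p (foldl push r w).
Proof.
elim: w r => //= a w IH r pr /andP[pa pw]; apply: IH => //; exact: all_push.
Qed.

End Stack.

(** * Triangulation in virtually free groups *)

Section VirtuallyFree.
Variables (G : groupType) (X : {fset G}).
Hypothesis Xgen : generates X.

(** [tau] picks a point of each right coset of [H]; the last clause holds because the coset of
    [x * y] depends only on [y] and the coset of [x]. *)
Lemma transversal (H : set G) : subgroup H -> finite_index H ->
  exists tau : G -> G, [/\ finite_set (range tau),
    forall x, H (x / tau x) & forall x y, tau (tau x * y) = tau (x * y)].
Proof.
move=> [H1 Hdiv] fiH; pose c (g : G) := [set h * g | h in H].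
have HV x : H x -> H x^-1 by move/(Hdiv _ _ H1); rewrite mul1g.
have HM x y : H x -> H y -> H (x * y).
  by move=> Hx /HV Hy; have := Hdiv _ _ Hx Hy; rewrite invgK.
have cE x y : H (x / y) -> c x = c y.
  move=> Hxy; apply/seteqP; split=> _ [h Hh <-].
    by exists (h * (x / y)); [exact: HM|gsimp].
  by exists (h * (y / x)); [apply: HM => //; rewrite -invgF; apply: HV|gsimp].
have Hc x y : c x = c y -> H (x / y).
  move=> xy; have : c y x by rewrite -xy; exists 1; rewrite ?mul1g.
  by move=> [h Hh <-]; gsimp.
pose T C := xget 1 [set x | c x = C].
have cT x : c (T (c x)) = c x 
  by apply: (@xgetPex _ 1 [set y | c y = c x]); exists x.
exists (T \o c); split=> [|x|x y].
- by rewrite -(image_comp c T); apply: finite_image.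
- by apply: Hc; rewrite /= cT.
- by congr T; apply: cE; gsimp; apply: Hc; rewrite /= cT.
Qed.

Lemma ball_stack_val (B : seq (G * bool)) : exists L, forall r,
  {subset r <= B} -> ball X (size r * L) (stack_val r).
Proof.
have [L BL] : exists L, [set` [seq fletter_val a | a <- B]] `<=` ball X L.
  apply: finite_sub_ball Xgen _ _; apply/finite_seqP.
  by exists [seq fletter_val a | a <- B].
exists L; elim=> [|a r IH] rB; first by rewrite stack_val_nil; apply: ball1.
rewrite stack_val_cons mulSn addnC; apply: ball_mul.
  by apply: IH => b br; apply: rB; rewrite inE br orbT.
by apply: BL => /=; apply: map_f; apply: rB; rewrite mem_head.
Qed.

(** The path is rewritten into [H] by Schreier's method and followed in the tree of reduced words
    over the basis. Each step changes the reduced word by a bounded number of letters, so cutting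
    ears at longest words needs only chords bounded independently of [s]. *)
Theorem triangulation n : virtually_free G ->
  exists2 m, n <= m & forall s : seq G, s <> [::] -> {in s, forall x, ball X n x} -> ball X n (gprod s) ->
  tri (ball X m) s.
Proof.
move=> [H [[subH [B [Bval Binj Bsurj]]] fiH]].
have [tau [tau_fin tauH tauM]] := transversal subH fiH.
(* The Schreier element contributed by a step [p.2] from the representative [p.1]. *)
pose sch p : G := p.1 * p.2 / tau (p.1 * p.2).
have schM x y : x * y / tau (x * y) = x / tau x * sch (tau x, y).
  by rewrite /sch /= tauM; gsimp.
have [Sigma SigmaE] : exists s : seq G,
    sch @` (range tau `*` ball X n) = [set` s].
  apply/finite_seqP/finite_image/finite_setX => //; exact: finite_ball.
have schS x y : ball X n y -> sch (tau x, y) \in Sigma.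
  by move=> yn; have : [set` Sigma] (sch (tau x, y)) by
    rewrite -SigmaE; exists (tau x, y) => //=; split=> //; exists x.
have SigmaH x : x \in Sigma -> H x.
  move=> xS; have : [set` Sigma] x by [].
  by rewrite -SigmaE => -[p _ <-]; apply: tauH.
pose rho h := xget [::] [set w | reduced_words B w /\ fword_val w = h].
have rhoP h : H h -> reduced_words B (rho h) /\ fword_val (rho h) = h.
  move=> /Bsurj[w wB wh].
  apply: (@xgetPex _ _ [set w | reduced_words B w /\ fword_val w = h]).
  by exists w.
(* The basis may be infinite, but only the letters in [B0] occur, and their lengths over [X] are
   bounded. *)
pose B0 := flatten (map rho Sigma).
have rhoB0 h : h \in Sigma -> {subset rho h <= B0}.
  by move=> hS a ah; apply/flatten_mapP; exists h.
have B0B a : a \in B0 -> B a.1.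
  by move=> /flatten_mapP[h /SigmaH/rhoP[[hB _] _]]; apply: hB.
pose D := \max_(h <- Sigma) size (rho h).
have rhoD h : h \in Sigma -> size (rho h) <= D.
  by move=> hS; apply: (@leq_bigmax_seq _ _ predT (fun h => size (rho h))).
have [L ballL] := ball_stack_val B0.
have [k tauk] := finite_sub_ball Xgen tau_fin.
(* Adjacent vertices differ by a product of four factors: an inverse representative, the inverse of
   the branch [x], the branch [y], and a representative. *)
pose m := k + D * L + (D * L + k).
exists (maxn n m); first exact: leq_maxl.
move=> s s0 sn pn.
(* A vertex carries a group element and the reduced word of its [H]-part. *)
pose V := (G * seq (G * bool))%type.
pose good (v : V) := [/\ v.1 = stack_val v.2 * tau v.1, reduced v.2 &
  {subset v.2 <= B0}].
pose E (v v' : V) := `[< [/\ good v, good v' & near D v.2 v'.2] >].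
have EF v v' : E v v' -> ball X (maxn n m) (v.1^-1 * v'.1).
  move=> /asboolP[[-> _ vB] [-> _ vB'] [x [y [p [vE vE' xD yD]]]]].
  have tauball g : ball X k (tau g) by apply: tauk; exists g.
  have small z : {subset z <= B0} -> size z <= D ->
      ball X (D * L) (stack_val z).
    move=> zB zD; apply: ball_sub (ballL z zB); exact: leq_mul.
  have := ball_mul (ball_mul (ball_inv (tauball v.1))
    (ball_inv (small x _ xD))) (ball_mul (small y _ yD) (tauball v'.1)).
  rewrite -/m vE vE' !stack_val_cat; gsimp => h.
  apply: (ball_sub (leq_maxr n m)); apply: h => a ax.
    by apply: vB; rewrite vE mem_cat ax.
  by apply: vB'; rewrite vE' mem_cat ax.
pose next (v : V) x : V :=
  (v.1 * x, foldl (@push G) v.2 (rho (sch (tau v.1, x)))).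
have next_good v x : good v -> ball X n x -> good (next v x).
  move=> [vE vr vB] xn; have xS := schS v.1 x xn; split=> /=.
  - rewrite stack_val_pushes (rhoP _ (SigmaH _ xS)).2.
    have <- : v.1 / tau v.1 = stack_val v.2 by rewrite {1}vE; gsimp.
    by rewrite -schM; gsimp.
  - exact: reduced_pushes.
  - by apply/allP; apply: all_pushes; apply/allP => //; apply: rhoB0.
have next_E v x : good v -> ball X n x -> E v (next v x).
  move=> gv xn; apply/asboolP; split=> //; first exact: next_good.
  by apply: near_leq (near_pushes _ _); apply/rhoD/schS.
have path_E v t : good v -> {in t, forall x, ball X n x} ->
    path E v (scanl next v t) /\ good (last v (scanl next v t)) /\
    (last v (scanl next v t)).1 = v.1 * gprod t.
  elim: t v => [|x t IH] v gv tn; first by rewrite gprod_nil mulg1.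
  have xn : ball X n x by apply: tn; rewrite mem_head.
  have [|pt [gt ->]] := IH _ (next_good _ _ gv xn).
    by move=> y yt; apply: tn; rewrite inE yt orbT.
  by rewrite /= next_E // gprod_cons mulgA; split.
have stepsE v t : pairmap (fun a b : V => a.1^-1 * b.1) v (scanl next v t) = t.
  by elim: t v => //= x t IH v; rewrite IH mulKg.
(* Starting at [tau 1] rather than at 1 makes the initial stack empty. *)
pose v0 : V := (tau 1, [::]).
have tau11 : tau (tau 1) = tau 1 by have := tauM 1 1; rewrite !mulg1.
have gv0 : good v0 by split=> //=; rewrite stack_val_nil mul1g tau11.
have [pE [[lE lr lB] l1]] := path_E _ _ gv0 sn.
rewrite -(stepsE v0 s); apply: (@tri_ear _ _ E (fun v => size v.2)) => //.
- move=> v v'; apply/asboolP/asboolP => -[? ? ?]; split=> //; exact: near_sym.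
- move=> v a b av bv /asboolP[ga gv nav] /asboolP[_ gb nvb]; apply/asboolP.
  by split=> //; apply: near_ear nav nvb.
(* The closing edge: the final stack spells the Schreier element of the whole product. Since reduced
   words are unique, it is the word chosen by [rho], of length at most [D]. *)
- apply/asboolP; split=> //; exists [::], (last v0 (scanl next v0 s)).2, [::].
  split; rewrite ?cats0 //; set r := _.2.
  have rE : stack_val r = sch (tau 1, gprod s).
    have {}l1 : (last v0 (scanl next v0 s)).1 = tau 1 * gprod s by exact: l1.
    by rewrite /sch /= -l1 {1}lE; gsimp.
  have [rhoB rhoE] := rhoP _ (SigmaH _ (schS 1 _ pn)).
  rewrite -size_rev; have <- : rho (sch (tau 1, gprod s)) = rev r.
    apply: Binj; rewrite ?inE // ; last by rewrite rhoE -rE.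
    split; last by rewrite -[sorted _ _]/(reduced (rev r)) reduced_rev.
    by move=> a; rewrite mem_rev => /lB/B0B.
  exact/rhoD/schS.
- by case: s s0 {sn pn pE lE lr lB l1}.
Qed.

End VirtuallyFree.

(** * Regularity of geodesics *)

Lemma exists_shortest (T : Type) (P : seq T -> Prop) : (exists w, P w) ->
  exists w, P w /\ forall w', P w' -> size w <= size w'.
Proof.
move=> [w Pw]; have [n] := ubnP (size w); elim: n w Pw => // n IH w Pw wn.
have [[w' [Pw' w'w]]|noshort] := pselect (exists w', P w' /\ size w' < size w).
  by apply: (IH w') => //; apply: leq_trans w'w _.
exists w; split=> // w' Pw'; rewrite leqNgt; apply/negP => w'w.
by apply: noshort; exists w'.
Qed.

Lemma map_eq_cat (T U : Type) (f : T -> U) w s t : map f w = s ++ t ->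
  exists u v, [/\ w = u ++ v, map f u = s & map f v = t].
Proof.
elim: s w => [|x s IH] w /=; first by exists [::], w.
by case: w => //= a w [<- /IH[u [v [-> <- <-]]]]; exists (a :: u), v.
Qed.

Section Geodesics.
Variables (G : groupType) (X : {fset G}).
Hypothesis Xgen : generates X.
Hypothesis vfG : virtually_free G.
Implicit Types w u v : word X.

Lemma geodesic_infix u v w : geodesic (u ++ v ++ w) -> geodesic v.
Proof.
move=> gw v' v'E; have := gw (u ++ v' ++ w).
rewrite !word_val_cat v'E => /(_ erefl).
by rewrite !size_cat leq_add2l leq_add2r.
Qed.

Lemma geodesic_size_ball v n :
  geodesic v -> ball X n (word_val v) -> size v <= n.
Proof. by move=> gv [w wn wv]; apply: leq_trans wn; apply: gv. Qed.

Lemma geodesic_size_le v w n : geodesic v ->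
  ball X n ((word_val w)^-1 * word_val v) -> size v <= size w + n.
Proof.
move=> gv vw; apply: geodesic_size_ball => //.
rewrite -(mulVKg (word_val w) (word_val v)); apply: ball_mul vw.
exact: ball_word.
Qed.

Lemma ball_take w i j : i <= j ->
  ball X (j - i) ((word_val (take i w))^-1 * word_val (take j w)).
Proof.
move=> ij.
rewrite -[take j w](cat_take_drop i) take_takel // word_val_cat mulKg.
exists (drop i (take j w)) => //.
by rewrite size_drop; apply: leq_sub2r; rewrite size_take_min geq_minl.
Qed.

(** The closed path along [w], [a] and back along [w'] is cut at index [i] of [w]. The central
    triangle leads from there to a point [w1] of [w'], and comparing lengths shows that this point
    has index close to [i]. *)
Lemma geodesic_fellow_travel : exists n, forall w a w',
  geodesic w -> geodesic w' -> word_val w' = word_val (rcons w a) ->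
  forall i, i <= size w ->
  ball X n ((word_val (take i w))^-1 * word_val (take i w')).
Proof.
have [m m1 trim] := triangulation Xgen 1 vfG.
(* The first [k] bounds the way from [w] to [w1] along [q] and two chords, the second the way along
   [w'] to index [i]. *)
pose k := m.+1 + m + m; exists (k + k) => w a w' gw gw' ww' i iw.
have : tri (ball X m)
    (steps (take i w) ++ steps (rcons (drop i w) a) ++ ginv (steps w')).
  apply: trim.
  - by move/(congr1 size); rewrite !size_cat !size_map size_rcons addSn addnS.
  - move=> x; rewrite !mem_cat => /or3P[|//|]; try exact: ball_steps.
    by apply: ball_ginv; apply: ball_steps.
  - rewrite !gprod_cat gprod_ginv !gprod_steps mulgA -word_val_cat ww'.
    by rewrite -rcons_cat cat_take_drop mulgV; apply: ball1.
case/(tri_center (ball1 _ _)) => [A [B [C [D [e [f []]]]]]].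
move=> /map_eq_cat[p [q [wpq _ <-]]] /map_eq_cat[c [d [wcd <- <-]]] w'E.
rewrite -map_cat gprod_steps gprod_cat gprod_steps => qcm dem.
have [w1 [w2 [w'12 w1E w2E]]] : exists w1 w2,
    [/\ w' = w1 ++ w2, steps w1 = ginv f & steps w2 = ginv e].
  by apply: map_eq_cat; rewrite -ginv_cat -w'E ginvK.
(* [q ++ c] is an infix of the geodesic [w] unless it ends in the letter [a]; removing [a] costs the
   extra 1. *)
have qm : size q <= m.+1.
  have gq c' d' : drop i w = c' ++ d' -> ball X m.+1 (word_val (q ++ c')) ->
      size q <= m.+1.
    move=> dE bq; apply: leq_trans (leq_addr (size c') _) _; rewrite -size_cat.
    apply: geodesic_size_ball bq; apply: (@geodesic_infix p _ d').
    by rewrite -!catA catA -wpq -dE cat_take_drop.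
  case/lastP: d wcd {dem} => [|d b].
    rewrite cats0 => cE; apply: (gq (drop i w) [::]); first by rewrite cats0.
    have -> : word_val (q ++ drop i w) = word_val (q ++ c) * (val a)^-1.
      by rewrite -cE -cats1 !word_val_cat [word_val [:: a]]big_seq1; gsimp.
    by rewrite -addn1; apply: ball_mul => //; apply/ball_inv/ball_letter.
  rewrite -rcons_cat => /rcons_inj[dE _]; apply: gq dE _.
  by apply: ball_sub qcm; apply: leqnSn.
have bk : ball X k ((word_val (take i w))^-1 * word_val w1).
  have := ball_mul (ball_mul (ball_inv (ball_word q)) qcm) dem.
  suff -> : (word_val (take i w))^-1 * word_val w1 =
      (word_val q)^-1 * word_val (q ++ c) * (word_val d * gprod e).
    by apply: ball_sub; rewrite /k !leq_add2r.
  have eE : gprod e = (word_val w2)^-1.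
    by rewrite -gprod_steps w2E gprod_ginv invgK.
  have E : word_val w1 * word_val w2 =
      word_val p * word_val q * (word_val c * word_val d).
    rewrite -!word_val_cat -w'12 -wpq -wcd ww' -rcons_cat.
    by rewrite cat_take_drop.
  have -> : word_val w1 = word_val p * word_val q * (word_val c * word_val d) *
      (word_val w2)^-1 by rewrite -E mulgK.
  by rewrite eE wpq !word_val_cat; gsimp.
have gi : geodesic (take i w).
  by apply: (@geodesic_infix [::] _ (drop i w)); rewrite cat_take_drop.
have g1 : geodesic w1.
  by apply: (@geodesic_infix [::] _ w2); rewrite /= -w'12.
(* Both points are ends of geodesics from the origin, so their indices differ by at most their
   distance. *)
have i1 : size w1 <= i + k.
  by have := geodesic_size_le g1 bk; rewrite size_takel.
have i2 : i <= size w1 + k.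
  have /ball_inv := bk; rewrite invgM invgK => /(geodesic_size_le gi).
  by rewrite size_takel.
have -> : (word_val (take i w))^-1 * word_val (take i w') =
  ((word_val (take i w))^-1 * word_val w1) *
  ((word_val w1)^-1 * word_val (take i w')) by gsimp.
apply: ball_mul => //.
have w1t : w1 = take (size w1) w' by rewrite w'12 take_size_cat.
have [le|/ltnW le] := leqP i (size w1).
  rewrite -[X in ball _ _ X]invgK; apply: ball_inv; rewrite invgM invgK {1}w1t.
  by apply: ball_sub (ball_take _ le); rewrite leq_subLR.
rewrite {1}w1t; apply: ball_sub (ball_take _ le); by rewrite leq_subLR.
Qed.

Section Automaton.
Variable n : nat.

(* A state holds the pairs [(w^-1 w', b)], for [w] the word read and [w'] a
   competing word not longer than [w], where [b] means that [w'] is shorter. *)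
Definition lag_state : finType := (n.-bseq (symm X) * bool)%type.

(** The competing word advances by at most one letter [u]; a pause makes it shorter for good. *)
Definition lag_delta (S : {set lag_state}) (a : symm X) : {set lag_state} :=
  finset (fun x : lag_state => `[< exists y u, [/\ y \in S, size u <= 1,
    word_val x.1 = (val a)^-1 * word_val y.1 * word_val u &
    x.2 = y.2 || (size u == 0)%N] >]).

Definition lag_init : {set lag_state} :=
  finset (fun x : lag_state => (word_val x.1 == 1) && ~~ x.2).

Definition lag_reach w := foldl lag_delta lag_init w.

Lemma lag_reach_rcons w a x : x \in lag_reach (rcons w a) <->
  exists y u, [/\ y \in lag_reach w, size u <= 1,
    word_val x.1 = (val a)^-1 * word_val y.1 * word_val u &
    x.2 = y.2 || (size u == 0)%N].
Proof. by rewrite /lag_reach foldl_rcons finset.in_set; split=> /asboolP. Qed.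

Lemma word_val_rcons w a : word_val (rcons w a) = word_val w * val a.
Proof. by rewrite -cats1 word_val_cat; congr (_ * _); apply: big_seq1. Qed.

Lemma lag_reach_sound w x : x \in lag_reach w ->
  exists w', word_val w' = word_val w * word_val x.1 /\ size w' + x.2 <= size w.
Proof.
elim/last_ind: w x => [|w a IH] x.
  rewrite finset.in_set => /andP[/eqP xE /negbTE ->]; exists [::].
  by rewrite xE !word_val_nil mulg1.
move=> /lag_reach_rcons[y [u [/IH[w' [w'E w'w]] u1 xE x2]]].
exists (w' ++ u); split.
  by rewrite xE word_val_cat word_val_rcons w'E; gsimp.
rewrite size_cat size_rcons x2; case: u u1 {xE x2} => [|b [|//]] _ /=.
  by rewrite addn0 orbT addn1 ltnS; apply: leq_trans w'w; apply: leq_addr.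
by rewrite orbF addn1 addSn ltnS.
Qed.

(** The run reads one letter of [w'] at a time and pauses once [w'] is exhausted, so the flag at
    time [i] is [size w' < i]. *)
Lemma lag_reach_complete w w' :
  (forall i, i <= size w ->
    ball X n ((word_val (take i w))^-1 * word_val (take i w'))) ->
  forall i (x : lag_state), i <= size w ->
  word_val x.1 = (word_val (take i w))^-1 * word_val (take i w') ->
  x.2 = (size w' < i) -> x \in lag_reach (take i w).
Proof.
move=> close; elim=> [|i IH] x iw xE x2.
  rewrite !take0 in xE *; rewrite finset.in_set x2 xE ltn0.
  by rewrite word_val_nil mulVg eqxx.
have a0 : symm X by case: (w) iw.
rewrite (take_nth a0) //; apply/lag_reach_rcons.
have [y yn yE] := close i (ltnW iw).
exists (Bseq yn, size w' < i), (take 1 (drop i w')); split.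
- by apply: IH => //; apply: ltnW.
- by rewrite size_take_min geq_minl.
- rewrite xE yE (take_nth a0) // word_val_rcons -addn1 takeD word_val_cat.
  by gsimp.
- have min1 k : (minn 1 k == 0)%N = (k == 0)%N by case: k => [|[|k]].
  by rewrite x2 size_take_min size_drop min1 subn_eq0 ltnS orb_idl // => /ltnW.
Qed.

Definition lag_bad (S : {set lag_state}) :=
  [exists x in S, (word_val x.1 == 1) && x.2].

Lemma lag_bad_rcons w a :
  lag_bad (lag_reach w) -> lag_bad (lag_reach (rcons w a)).
Proof.
move=> /existsP[x /and3P[xS /eqP xE x2]]; apply/existsP; exists x.
rewrite xE x2 eqxx !andbT; apply/lag_reach_rcons; exists x, [:: a].
by rewrite xE x2 [word_val [:: a]]big_seq1 mulg1 mulVg.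
Qed.

End Automaton.

(** A bad state stays bad, so the only case to detect is a non-geodesic [rcons w a] with [w]
    geodesic. Its geodesic competitor fellow-travels with [w], hence is tracked by the finite
    automaton. *)
Theorem geodesic_regular : exists (Q : finType) (delta : Q -> symm X -> Q)
  (q0 : Q) (F : pred Q), forall w, geodesic w <-> F (foldl delta q0 w).
Proof.
have [n fellow] := geodesic_fellow_travel.
exists {set lag_state n}, (@lag_delta n), (lag_init n), (predC (@lag_bad n)) => w.
rewrite -/(lag_reach n w) /=; split=> [gw|].
  apply/existsP => -[x /and3P[xS /eqP xE x2]].
  have [w' [w'E]] := lag_reach_sound xS.
  rewrite x2 addn1 ltnNge => /negP; apply.
  by apply: gw; rewrite w'E xE mulg1.
elim/last_ind: w => [|w a IH]; first by move=> _ w'.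
move=> nbad; have /IH gw : ~~ lag_bad (lag_reach n w).
  by apply: contra nbad; apply: lag_bad_rcons.
apply: contrapT => ng; move/negP: nbad; apply.
have [|w' [w'E w'min]] := @exists_shortest _
  (fun w' : word X => word_val w' = word_val (rcons w a)).
  by exists (rcons w a).
have gw' : geodesic w' by move=> w'' w''E; apply: w'min; rewrite w''E.
have w'lt : size w' < (size w).+1.
  rewrite ltnNge; apply/negP => le; apply: ng => w'' w''E.
  by rewrite size_rcons; apply: leq_trans le _; apply: w'min.
pose x : lag_state n := ([bseq], true).
apply/existsP; exists x; rewrite word_val_nil eqxx !andbT.
have w't : take (size w).+1 w' = w' by rewrite take_oversize // ltnW.
have wt : take (size w).+1 (rcons w a) = rcons w a.
  by rewrite take_oversize // size_rcons.
rewrite -wt; apply: (@lag_reach_complete n _ w') => [i||//|//].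
- rewrite size_rcons leq_eqVlt => /predU1P[->|].
    by rewrite w't wt w'E mulVg; apply: ball1.
  rewrite ltnS => iw; rewrite -cats1 takel_cat //.
  exact: fellow gw gw' w'E _ iw.
- by rewrite size_rcons.
- by rewrite w't wt w'E mulVg word_val_nil.
Qed.

End Geodesics.

(** * The grammar of a conjugacy closure *)

Lemma conj_closureJ (G : groupType) (K : set G) x y :
  conj_closure K x -> conj_closure K (y^-1 * x * y).
Proof.
move=> [u _ [k Kk <-]]; exists (u * y) => //; exists k => //; by gsimp.
Qed.

Lemma conj_closureC (G : groupType) (K : set G) x y :
  conj_closure K (x * y) -> conj_closure K (y * x).
Proof. by move/(@conj_closureJ _ _ _ x); gsimp. Qed.

Section Run.
Variables (G : groupType) (Q : finType) (e : Q -> G -> Q -> Prop).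

Fixpoint run (s : Q) (l : seq G) (t : Q) : Prop :=
  if l is x :: l' then exists2 r, e s x r & run r l' t else s = t.

Lemma run_cat s l l' t :
  run s (l ++ l') t <-> exists2 r, run s l r & run r l' t.
Proof.
elim: l s => [|x l IH] s /=.
  by split=> [st|[_ <-]] //; exists s.
split=> [[r sr /IH[r' rr' r't]]|[r' [r sr rr'] r't]].
  by exists r' => //; exists r.
by exists r => //; apply/IH; exists r'.
Qed.

End Run.

Section ConjugacyGrammar.
Variables (G : groupType) (X : {fset G}) (K : set G) (Q : finType).
Variables (e : Q -> G -> Q -> Prop) (loop : Q -> Q -> Prop) (n0 : nat).
Hypothesis Xgen : generates X.
Hypothesis vfG : virtually_free G.
Hypothesis n0_gt0 : 0 < n0.
Hypothesis e_ball : forall s x t, e s x t -> ball X n0 x.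
(** Pairs in [loop] stand for closed runs of a cyclic automaton for [K]: rotating such a run gives
    another one, possibly based at a different state. *)
Hypothesis loop_sound : forall s t l, loop s t -> run e s l t ->
  conj_closure K (gprod l).
Hypothesis loop_complete : forall k, K k -> exists s t l,
  [/\ loop s t, run e s l t & gprod l = k].
Hypothesis loop_rot : forall s t l l', loop s t -> run e s (l ++ l') t ->
  exists s' t', loop s' t' /\ run e s' (l' ++ l) t'.

Lemma run_ball s l t n : n0 <= n -> run e s l t -> {in l, forall x, ball X n x}.
Proof.
move=> n0n; elim: l s => //= x l IH s [r sr rt] y; rewrite inE => /predU1P[->|].
  exact: ball_sub n0n _ (e_ball sr).
by apply: IH rt _.
Qed.

Section Nonterminals.
Variable n : nat.
Local Notation bw := (n.-bseq (symm X)).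

(** Short elements are given by bounded words, which form a finite type; the conditions depend only
    on their values. *)
Definition nonterm : finType := (bw + bw + bw * Q * Q * bw)%type.

Definition Val (a : bw) : nonterm := inl (inl a).
Definition Conj (f : bw) : nonterm := inl (inr f).
Definition Run (x : bw) (s t : Q) (y : bw) : nonterm := inr (x, s, t, y).

Definition nonterm_sem (i : nonterm) : set (word X) :=
  match i with
  | inl (inl a) => [set w | word_val w = word_val a]
  | inl (inr f) => [set w | conj_closure K (word_val w * word_val f)]
  | inr (x, s, t, y) => [set w | exists2 l, run e s l t &
      word_val w = word_val x * gprod l * (word_val y)^-1]
  end.

Local Notation gen := (gen nonterm_sem).

(** The triangulation is itself the parse tree, each chord giving a nonterminal. *)
Lemma gen_Val s w (a : bw) : tri (ball X n) s -> steps w = s ->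
  word_val w = word_val a -> gen (Val a) w.
Proof.
move=> ts; elim: ts w a => {s} [x _|s t ts IHs tt IHt _] w a.
  by case: w => [|b [|//]] // _ wa; apply: gen_letter.
move=> /map_eq_cat[u [v [-> us vt]]] uva.
have [b bn bE] := tri_gprod ts; have [c cn cE] := tri_gprod tt.
apply: (@gen_cat _ _ _ _ (Val (Bseq bn)) (Val (Bseq cn))).
- move=> u' v' /= u'E v'E.
  by rewrite word_val_cat u'E v'E bE cE -uva word_val_cat -us -vt !gprod_steps.
- by apply: IHs => //=; rewrite bE -us gprod_steps.
- by apply: IHt => //=; rewrite cE -vt gprod_steps.
Qed.

(** [u w f] and [w f u] are conjugate. *)
Lemma gen_Conj_l (f f' : bw) u w : tri (ball X n) (steps u) ->
  word_val f' = word_val f * word_val u ->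
  gen (Conj f') w -> gen (Conj f) (u ++ w).
Proof.
move=> tu f'E; have [b bn] := tri_gprod tu; rewrite gprod_steps => bE.
apply: (@gen_cat _ _ _ _ (Val (Bseq bn)) (Conj f')); last exact: gen_Val tu _ _.
move=> u' v' /= u'E; rewrite f'E mulgA => /conj_closureC; rewrite mulgA.
by rewrite word_val_cat u'E bE.
Qed.

Lemma gen_Conj_r (f f' : bw) u w : tri (ball X n) (steps u) ->
  word_val f' = word_val u * word_val f ->
  gen (Conj f') w -> gen (Conj f) (w ++ u).
Proof.
move=> tu f'E gw; have [b bn] := tri_gprod tu; rewrite gprod_steps => bE.
apply: (gen_cat _ gw (gen_Val (a := Bseq bn) tu erefl (esym bE))).
move=> u' v' /=; rewrite f'E => + v'E.
by rewrite word_val_cat v'E bE mulgA.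
Qed.

(** Peeling letter by letter would not keep the remaining condition short. The order is dictated by
    the triangulation: of the two pieces of [w3 ++ w1], one lies within [w3] or [w1] and is absorbed
    by a single rule, the other is peeled by induction. *)
Lemma gen_peel s w1 w2 w3 (f g : bw) : tri (ball X n) s ->
  steps (w3 ++ w1) = s -> word_val f = word_val w3 * word_val g * word_val w1 ->
  word_val g = 1 -> gen (Conj f) w2 -> gen (Conj g) (w1 ++ w2 ++ w3).
Proof.
move=> ts sE fE g1; rewrite g1 mulg1 in fE.
elim: ts w1 w2 w3 f fE sE => {s} [x xn|s t ts IHs tt IHt st] w1 w2 w3 f fE.
  move=> sE; have txs : tri (ball X n) (steps (w3 ++ w1)).
    by rewrite sE; apply: tri1.
  case: w3 sE fE txs => [|a w3] /=.
    move=> _; rewrite word_val_nil mul1g cats0 => fE tw1.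
    by apply: gen_Conj_l; rewrite // g1 mul1g.
  case=> _; case: w3; case: w1 => // _; rewrite word_val_nil mulg1 => fE ta /=.
  by apply: gen_Conj_r; rewrite // g1 mulg1.
rewrite [steps _]map_cat -/(steps w3) -/(steps w1).
case/cat_eq_cat => [[m [w3E tE]]|[m [sE w1E]]].
  case/map_eq_cat: w3E => [u [v [w3E uE vE]]].
  have tvw : t = steps (v ++ w1) by rewrite /steps map_cat vE.
  have [c cn] := tri_gprod tt; rewrite tvw gprod_steps => cE.
  rewrite w3E (catA w2) => fw.
  apply: (IHt w1 (w2 ++ u) v (Bseq cn)); rewrite ?cE ?word_val_cat -?tvw //.
  apply: gen_Conj_r fw; rewrite ?[steps u]uE //.
  by rewrite fE w3E cE !word_val_cat mulgA.
case/map_eq_cat: w1E => [u [v [w1E uE vE]]].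
have swu : s = steps (w3 ++ u) by rewrite /steps map_cat uE.
have [c cn] := tri_gprod ts; rewrite swu gprod_steps => cE.
rewrite w1E -!catA (catA v) => fw.
apply: (IHs u (v ++ w2) w3 (Bseq cn)); rewrite ?cE ?word_val_cat -?swu //.
apply: gen_Conj_l fw; rewrite ?[steps v]vE //.
by rewrite fE w1E cE !word_val_cat mulgA.
Qed.

(** A chord either cuts off a prefix of [v], read by [Val], or cuts off a part of [ginv l], which
    shortens the run. The piece containing [y] is again of the same form. *)
Lemma gen_Run p s t (x y : bw) v l : tri (ball X n) p ->
  p = steps v ++ word_val y :: ginv l -> run e s l t ->
  word_val x = gprod p -> gen (Run x s t y) v.
Proof.
move=> tp; elim: tp s t x v l => {p} [g _|p1 p2 tp1 IH1 tp2 IH2 _] s t x v l.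
  case: v => [|a [|//]] //= -[-> lE] lst xE.
  apply: gen_nil => /=; exists l => //.
  have -> : l = [::] by rewrite -(ginvK l) -lE.
  by rewrite xE gprod_nil gprod1 word_val_nil; gsimp.
case/esym/cat_eq_cat => [[m [vE p2E]]|[m [p1E mE]]] lst xE.
  case/map_eq_cat: vE => [u [v' [-> uE v'E]]].
  have [a an aE] := tri_gprod tp1; have [z zn zE] := tri_gprod tp2.
  apply: (@gen_cat _ _ _ _ (Val (Bseq an)) (Run (Bseq zn) s t y)).
  - move=> w1 w2 /= w1E [l' l'st w2E]; exists l' => //.
    by rewrite word_val_cat w1E w2E aE zE xE gprod_cat; gsimp.
  - by apply: (gen_Val tp1 uE); rewrite /= aE -uE gprod_steps.
  - by apply: (IH2 _ _ (Bseq zn) _ _ _ lst zE); rewrite p2E -v'E.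
case: m p1E mE => [|g m] p1E.
  move=> /= p2E; rewrite cats0 in p1E.
  have [a an aE] := tri_gprod tp1; have [z zn zE] := tri_gprod tp2.
  rewrite -[v]cats0.
  apply: (@gen_cat _ _ _ _ (Val (Bseq an)) (Run (Bseq zn) s t y)).
  - move=> w1 w2 /= w1E [l' l'st w2E]; exists l' => //.
    by rewrite word_val_cat w1E w2E aE zE xE gprod_cat; gsimp.
  - by apply: gen_Val tp1 (esym p1E) _; rewrite /= aE p1E gprod_steps.
  - by apply: (IH2 _ _ (Bseq zn) _ _ _ lst zE); rewrite -p2E.
case=> gE lE; have l12 : l = ginv p2 ++ ginv m.
  by rewrite -(ginvK l) lE ginv_cat.
move: lst; rewrite l12 => /run_cat[r sr rt].
have [z zn zE] := tri_gprod tp1.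
(* The rule removes [ginv p2] from the front of the run and reads no letter; [Val [bseq]] makes it
   binary. *)
rewrite -[v]cat0s.
apply: (@gen_cat _ _ _ _ (Val [bseq]) (Run (Bseq zn) r t y)).
- move=> w1 w2 /= w1E [l' l'rt w2E]; exists (ginv p2 ++ l').
    by apply/run_cat; exists r.
  rewrite word_val_cat w1E w2E word_val_nil zE xE !gprod_cat gprod_ginv.
  by gsimp.
- exact: gen_nil.
- by apply: (IH1 _ _ (Bseq zn) _ _ _ rt zE); rewrite p1E gE ginvK.
Qed.

Lemma gen_Conj_Run s t (f x y : bw) w : loop s t ->
  word_val y = word_val f * word_val x -> gen (Run x s t y) w -> gen (Conj f) w.
Proof.
move=> st yE gw; rewrite -[w]cat0s.
apply: (@gen_cat _ _ _ _ (Val [bseq]) (Run x s t y)) => //; last exact: gen_nil.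
move=> w1 w2 /= w1E [l lst w2E]; rewrite word_val_cat w1E w2E word_val_nil yE.
have := conj_closureJ (word_val x)^-1 (loop_sound st lst); by gsimp.
Qed.

End Nonterminals.

(** Of the two chords of the central triangle, one joins [w] to [u]. The other joins [u] to the side
    of [l], which gives a conjugate of a rotation of [l], or to the second copy of [u], where
    minimality applies. *)
Lemma conj_closure_split : exists2 m, n0 <= m & forall w : word X,
  conj_closure K (word_val w) -> exists w1 w2, w = w1 ++ w2 /\
  (ball X m (word_val (w2 ++ w1)) \/
   exists x s t l, [/\ ball X m x, loop s t, run e s l t &
     word_val (w2 ++ w1) = x * gprod l * x^-1]).
Proof.
have [m n0m trim] := triangulation Xgen n0 vfG.
(* In the short case the rotation is a product of four factors in the ball of radius [m]: [w2 c],
   [c^-1 c'], [z^-1] and [(w2 c)^-1]. *)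
exists (m + m + m + m).
  by rewrite -!addnA; apply: leq_trans n0m (leq_addr _ _).
move=> w wK.
have [|u [[l [s [t [st lst uE]]]] umin]] := @exists_shortest (symm X)
  (fun u : word X => exists l s t, [/\ loop s t, run e s l t &
     word_val w * word_val u = word_val u * gprod l]).
  case: wK => [g _ [k Kk wE]]; have [u uE] := Xgen g^-1; exists u.
  have [s [t [l [st lst lk]]]] := loop_complete Kk.
  exists l, s, t; split=> //; rewrite -wE uE lk; by gsimp.
have [w0|wn0] := pselect (w = [::]).
  exists [::], [::]; split=> //; left; rewrite word_val_nil; exact: ball1.
have : tri (ball X m) (steps w ++ steps u ++ ginv (steps u ++ l)).
  apply: trim.
  - by move=> E; apply: wn0; case: (w) E.
  - move=> x; rewrite !mem_cat => /or3P[||]; try exact: ball_steps.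
    apply: ball_ginv => {}x; rewrite mem_cat => /orP[]; first exact: ball_steps.
    exact: run_ball lst _.
  - rewrite !gprod_cat gprod_ginv gprod_cat !gprod_steps -uE; gsimp.
    exact: ball1.
case/(tri_center (ball1 _ _)) => [A [B [C [D [E [F []]]]]]].
move=> /map_eq_cat[w1 [w2 [wE _ <-]]] /map_eq_cat[c [d [ucd <- <-]]] ulE.
rewrite -map_cat gprod_steps gprod_cat gprod_steps word_val_cat => w2c dE.
exists w1, w2; split=> //; rewrite ginv_cat in ulE.
case/cat_eq_cat: ulE => [[l2 [lE _]]|[e2 [EE FE]]].
  right.
  have l12 : l = ginv l2 ++ ginv E by rewrite -ginv_cat -lE ginvK.
  move: (lst); rewrite l12 => /(loop_rot st)[s' [t' [st' lst']]].
  exists (word_val w2 * word_val u * gprod E), s', t', (ginv E ++ ginv l2).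
  split=> //.
    have := ball_mul w2c dE; rewrite ucd word_val_cat; gsimp.
    by apply: ball_sub; rewrite -!addnA addnA leq_addr.
  move: uE; rewrite l12 wE !gprod_cat !word_val_cat !gprod_ginv => uE.
  have -> : word_val w1 = word_val u * (gprod l2)^-1 * (gprod E)^-1 *
      (word_val u)^-1 * (word_val w2)^-1.
    by rewrite -(mulgA (word_val u)) -uE; gsimp.
  by gsimp.
left.
have [c' [d' [uE' c'E d'E]]] : exists c' d' : word X,
    [/\ u = c' ++ d', steps c' = ginv F & steps d' = ginv e2].
  by apply: map_eq_cat; rewrite -ginv_cat -FE ginvK.
have e2E : gprod e2 = (word_val d')^-1.
  by rewrite -gprod_steps d'E gprod_ginv invgK.
rewrite EE gprod_cat gprod_ginv e2E in dE; set z := _ * _ in dE.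
have wcz : word_val w * word_val c * z = word_val c'.
  have -> : word_val w * word_val c * z =
      word_val w * word_val u * (gprod l)^-1 * (word_val d')^-1.
    by rewrite /z ucd word_val_cat; gsimp.
  by rewrite uE uE' word_val_cat; gsimp.
(* With [u] also [w u] and [w^-1 u] solve the equation. They equal [c' z^-1 d] and [c z d'], so
   minimality of [u = c d = c' d'] bounds the difference of the lengths of [c] and [c']. *)
have cle : size c <= size c' + m.
  have [zw zwm zwE] := ball_inv dE.
  have := umin (c' ++ zw ++ d); rewrite ucd !size_cat addnA leq_add2r => cz.
  apply: leq_trans (cz _) _; last by rewrite leq_add2l.
  exists l, s, t; split=> //.
  have -> : word_val (c' ++ zw ++ d) = word_val w * word_val u.
    by rewrite !word_val_cat zwE -wcz ucd word_val_cat; gsimp.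
  by rewrite {1}uE; gsimp.
have c'le : size c' <= size c + m.
  have [zw zwm zwE] := dE.
  have := umin (c ++ zw ++ d'); rewrite {1}uE' !size_cat addnA leq_add2r => cz.
  apply: leq_trans (cz _) _; last by rewrite leq_add2l.
  exists l, s, t; split=> //.
  have -> : word_val (c ++ zw ++ d') = (word_val w)^-1 * word_val u.
    by rewrite !word_val_cat zwE uE' word_val_cat -wcz; gsimp.
  by rewrite -mulgA -uE; gsimp.
have cc' : ball X m ((word_val c)^-1 * word_val c').
  have cu : c = take (size c) u by rewrite ucd take_size_cat.
  have c'u : c' = take (size c') u by rewrite uE' take_size_cat.
  have [le|/ltnW le] := leqP (size c) (size c').
    by rewrite {1}cu {1}c'u; apply: ball_sub (ball_take _ le); rewrite leq_subLR.
  rewrite -[X in ball _ _ X]invgK; apply: ball_inv; rewrite invgM invgK.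
  by rewrite {1}cu {1}c'u; apply: ball_sub (ball_take _ le); rewrite leq_subLR.
have := ball_mul (ball_mul (ball_mul w2c cc') (ball_inv dE)) (ball_inv w2c).
rewrite -wcz wE !word_val_cat; by gsimp.
Qed.

Lemma gen_peel_ball n m : (forall s : seq G, s <> [::] ->
    {in s, forall x, ball X n x} -> ball X n (gprod s) -> tri (ball X m) s) ->
  0 < n -> forall w3 w1 : word X, ball X n (word_val (w3 ++ w1)) -> n <= m ->
  exists2 f : m.-bseq (symm X), word_val f = word_val (w3 ++ w1) &
  forall w2, gen (@nonterm_sem m) (Conj f) w2 ->
    gen (@nonterm_sem m) (Conj [bseq]) (w1 ++ w2 ++ w3).
Proof.
move=> trim n_gt0 w3 w1 b nm; have [w31|w31] := pselect (w3 ++ w1 = [::]).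
  exists [bseq]; first by rewrite w31.
  by case: w3 w1 w31 {b} => // -[] // _ w2; rewrite cats0.
have [f fm fE] := ball_sub nm b; exists (Bseq fm) => // w2 gf.
apply: (@gen_peel _ (steps (w3 ++ w1)) _ _ _ (Bseq fm)) => //.
- apply: trim; [|exact: ball_steps|by rewrite gprod_steps].
  by move: w31; case: (w3 ++ w1).
- by rewrite /= fE word_val_nil mulg1 word_val_cat.
- exact: word_val_nil.
Qed.

(** In the long case [w = c d a b] with [b c] short. [Conj] peels off [b] and [c], and [Run] reads
    [d a], which runs close to a rotation of [l]. *)
Theorem gen_Conj_complete : exists n, forall w : word X,
  conj_closure K (word_val w) -> gen (@nonterm_sem n) (Conj [bseq]) w.
Proof.
have [m n0m split_w] := conj_closure_split.
have [m2 mm2 trim2] := triangulation Xgen m vfG.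
(* This bounds [b c] (by [m2]), [z] (by [m2 + m]) and their product, which labels the far end of the
   run. *)
pose n3 := m2 + (m2 + m).
have [n n3n trim3] := triangulation Xgen n3 vfG.
have m_gt0 : 0 < m by apply: leq_trans n0m.
have mn3 : m <= n3 by rewrite /n3 addnA leq_addl.
have n3_gt0 : 0 < n3 by apply: leq_trans mn3.
exists n => w wK; have [w1 [w2 [wE]]] := split_w w wK.
case=> [short|[x [s [t [l [xm st lst w21]]]]]].
  have [f fE peel] := gen_peel_ball trim3 n3_gt0 (ball_sub mn3 short) n3n.
  rewrite wE -[w2]cat0s; apply: peel; apply: gen_nil => /=.
  rewrite fE word_val_nil mul1g word_val_cat; apply: conj_closureC.
  by rewrite -word_val_cat -wE.
have [w21n|w21n] := pselect (w2 ++ w1 = [::]).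
  have short : ball X n3 (word_val (w2 ++ w1)).
    by rewrite w21n word_val_nil; apply: ball1.
  have [f fE peel] := gen_peel_ball trim3 n3_gt0 short n3n.
  rewrite wE -[w2]cat0s; apply: peel; apply: gen_nil => /=.
  rewrite fE word_val_nil mul1g word_val_cat; apply: conj_closureC.
  by rewrite -word_val_cat -wE.
have : tri (ball X m2) (steps w2 ++ steps w1 ++ (x :: ginv l)).
  apply: trim2.
  - rewrite catA -[steps w2 ++ _]map_cat; by case: (w2 ++ w1) w21n.
  - move=> y; rewrite !mem_cat inE => /or4P[||/eqP->//|]; try exact: ball_steps.
    exact/ball_ginv/(run_ball n0m lst).
  - rewrite catA -[steps w2 ++ _]map_cat gprod_cat gprod_cons gprod_steps w21.
    by rewrite gprod_ginv; gsimp.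
case/(tri_center (ball1 _ _)) => [A [B [C [D [E [F []]]]]]].
move=> /map_eq_cat[a [b [w2E _ <-]]] /map_eq_cat[c [d [w1E <- <-]]] xlE.
rewrite -map_cat gprod_steps gprod_cat gprod_steps => bc dE.
(* If the chord from [w1] ends before [x], then [z = d x]; otherwise it ends along [l], which is
   rotated to start there. *)
have [z [s' [t' [l' [zm st' lst' dabc]]]]] : exists z s' t' l',
    [/\ ball X (m2 + m) z, loop s' t', run e s' l' t' &
     word_val (d ++ a) * word_val (b ++ c) = z * gprod l' * z^-1].
  have dabc : word_val (d ++ a) * word_val (b ++ c) =
      word_val d * (x * gprod l * x^-1) * (word_val d)^-1.
    by rewrite -w21 w2E w1E !word_val_cat; gsimp.
  case: E xlE dE => [_|x' E [<- lE]] dE.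
    rewrite gprod_nil mulg1 in dE.
    exists (word_val d * x), s, t, l; split=> //; first exact: ball_mul.
    by rewrite dabc; gsimp.
  have l12 : l = ginv F ++ ginv E by rewrite -ginv_cat -lE ginvK.
  move: lst; rewrite l12 => /(loop_rot st)[s' [t' [st' lst']]].
  exists (word_val d * gprod (x :: E)), s', t', (ginv E ++ ginv F).
  split=> //; first by apply: ball_sub dE; apply: leq_addr.
  by rewrite dabc l12 !gprod_cat !gprod_ginv gprod_cons; gsimp.
have fz := ball_mul bc zm.
have zn3 : ball X n3 z by apply: ball_sub zm; apply: leq_addl.
have [f fE peel] := gen_peel_ball trim3 n3_gt0
  (ball_sub (leq_addr (m2 + m) m2) bc) n3n.
have [zb zbn zbE] := ball_sub n3n zn3.
have [yb ybn ybE] := ball_sub n3n fz.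
rewrite wE w1E w2E -catA (catA d); apply: peel.
apply: (@gen_Conj_Run n s' t' f (Bseq zbn) (Bseq ybn)) => //.
  by rewrite /= ybE zbE fE.
(* The last polygon has sides [d a], [(b c) z] and the inverse of [l']; it is closed by [z]. *)
have pE : gprod (steps (d ++ a) ++ (word_val yb :: ginv l')) = z.
  rewrite gprod_cat gprod_cons gprod_steps gprod_ginv ybE.
  have -> : word_val (d ++ a) = z * gprod l' * z^-1 * (word_val (b ++ c))^-1.
    by rewrite -dabc mulgK.
  by gsimp.
apply: (@gen_Run _ (steps (d ++ a) ++ (word_val yb :: ginv l'))
  _ _ _ _ _ l') => //.
  apply: trim3; last by rewrite pE.
  - by case: (steps _).
  - move=> y; rewrite mem_cat inE => /or3P[|/eqP->|]; first exact: ball_steps.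
      by rewrite ybE.
    exact/ball_ginv/(run_ball (leq_trans n0m mn3) lst').
by rewrite pE.
Qed.

End ConjugacyGrammar.

(** * Rational subsets *)

Section CyclicAutomaton.
Variables (G : groupType) (Y : {fset G}) (M : nfa (symm Y)).

Definition nfa_edge (p : nfa_state M) (x : G) (q : nfa_state M) : Prop :=
  exists2 a, nfa_trans p a q & x = val a.

(* Two copies of the automaton; passing from the first to the second stands for
   leaving at a final state and starting again at an initial one. *)
Definition cyc_edge (p : nfa_state M * bool) (x : G)
    (q : nfa_state M * bool) : Prop :=
  (p.2 = q.2 /\ nfa_edge p.1 x q.1) \/
  [/\ p.2 = false, q.2 = true, x = 1, p.1 \in nfa_final M & q.1 \in nfa_init M].

(** A run between the two copies of one state crosses over exactly once, so its label
    [l1 ++ 1 :: l2] gives the label [l2 ++ l1] of an accepting run. *)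
Definition cyc_loop (p q : nfa_state M * bool) : Prop :=
  [/\ p.1 = q.1, p.2 = false & q.2 = true].

Lemma nfa_accept_run p (w : word Y) : nfa_accept_from p w <->
  exists2 f, f \in nfa_final M & run nfa_edge p (steps w) f.
Proof.
elim: w p => [|a w IH] p /=; first by split=> [pf|[f ff ->]] //; exists p.
split=> [[q pq /IH[f ff qf]]|[f ff [q [b pq ab] qf]]].
  by exists f => //; exists q => //; exists a.
by exists q; [rewrite (val_inj ab)|apply/IH; exists f].
Qed.

Lemma run_nfa_steps p l q : run nfa_edge p l q ->
  exists w : word Y, steps w = l.
Proof.
elim: l p => [|x l IH] p /=; first by exists [::].
by move=> [r [a _ ->] /IH[w <-]]; exists (a :: w).
Qed.

Lemma run_cyc_level p l q b :
  run nfa_edge p l q -> run cyc_edge (p, b) l (q, b).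
Proof.
elim: l p => [|x l IH] p /=; first by move=> ->.
by move=> [r pr rq]; exists (r, b); [left|apply: IH].
Qed.

Lemma run_cyc_true p l q b : run cyc_edge (p, true) l (q, b) ->
  b = true /\ run nfa_edge p l q.
Proof.
elim: l p => [|x l IH] p /=; first by case=> -> <-.
move=> [[r c] [[/= <- pr] /IH[-> rq]|[]//]].
by split=> //; exists r.
Qed.

Lemma run_cyc_false p l q b : run cyc_edge (p, false) l (q, b) ->
  if b then exists l1 l2 f i, [/\ l = l1 ++ 1 :: l2,
      f \in nfa_final M, i \in nfa_init M,
      run nfa_edge p l1 f & run nfa_edge i l2 q]
  else run nfa_edge p l q.
Proof.
elim: l p => [|x l IH] p /=; first by case=> -> <-.
move=> [[r c] [[/= <- pr] /IH|[_ /= -> -> pf ri] /run_cyc_true[-> rq]]].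
  case: b {IH} => [[l1 [l2 [f [i [-> ff ii rf iq]]]]]|rq]; last by exists r.
  by exists (x :: l1), l2, f, i; split=> //; exists r.
by exists [::], l, p, r.
Qed.

Lemma run_cyc_shift p l q b c : run cyc_edge (p, b) l (q, b) ->
  run cyc_edge (p, c) l (q, c).
Proof.
by case: b => [/run_cyc_true[_]|/run_cyc_false]; apply: run_cyc_level.
Qed.

Lemma cyc_loop_sound s t l : cyc_loop s t -> run cyc_edge s l t ->
  conj_closure (@word_val G Y @` nfa_lang M) (gprod l).
Proof.
case: s t => [p b] [q c] [/= -> -> ->] /run_cyc_false.
move=> [l1 [l2 [f [i [-> ff ii qf iq]]]]].
have iqf : run nfa_edge i (l2 ++ l1) f by apply/run_cat; exists q.
have [w wE] := run_nfa_steps iqf.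
rewrite gprod_cat gprod_cons mul1g; apply: conj_closureC; rewrite -gprod_cat -wE.
exists 1 => //; exists (word_val w); last by rewrite gprod_steps; gsimp.
by exists w => //; exists i => //; apply/nfa_accept_run; exists f; rewrite ?wE.
Qed.

Lemma cyc_loop_complete k : (@word_val G Y @` nfa_lang M) k ->
  exists s t l, [/\ cyc_loop s t, run cyc_edge s l t & gprod l = k].
Proof.
move=> [w [i ii /nfa_accept_run[f ff wif]] <-].
exists (f, false), (f, true), (1 :: steps w); split=> //=.
  by exists (i, true); [right|apply: run_cyc_level].
by rewrite gprod_cons mul1g gprod_steps.
Qed.

Lemma cyc_loop_rot s t l l' : cyc_loop s t -> run cyc_edge s (l ++ l') t ->
  exists s' t', cyc_loop s' t' /\ run cyc_edge s' (l' ++ l) t'.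
Proof.
case: s t => [p b] [q c] [/= -> -> ->] /run_cat[[r d] qr rq].
exists (r, false), (r, true); split=> //; apply/run_cat.
(* One of the two pieces stays within one copy; it is moved to the other copy. *)
by case: d qr rq => qr rq; [exists (q, false)|exists (q, true)] => //;
   apply: run_cyc_shift; eassumption.
Qed.

Lemma cyc_edge_ball (X : {fset G}) : generates X ->
  exists2 n, 0 < n & forall s x t, cyc_edge s x t -> ball X n x.
Proof.
move=> Xgen; have [n Yn] : exists n, range (val : symm Y -> G) `<=` ball X n.
  by apply: finite_sub_ball Xgen _ _; apply/finite_image/finite_finset.
exists n.+1 => // s x t [[_ [a _ ->]]|[_ _ -> _ _]]; last exact: ball1.
by apply: (ball_sub (leqnSn n)); apply: Yn; exists a.
Qed.

End CyclicAutomaton.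

Theorem theorem3p21 (G : groupType) (K : set G)
    (fgG : finitely_generated G) (vfG : virtually_free G) (ratK : rational K) :
  forall X : {fset G}, generates X -> context_free (@Geo G X (conj_closure K)).
Proof.
move=> X Xgen; have [Y [_ [_ [[M ->] KE]]]] := ratK.
have [n0 n0_gt0 edge_ball] := cyc_edge_ball M Xgen.
have [n gen_complete] := gen_Conj_complete Xgen vfG n0_gt0 edge_ball
  (@cyc_loop_sound _ _ M) (@cyc_loop_complete _ _ M) (@cyc_loop_rot _ _ M).
have [Q [delta [q0 [F geoE]]]] := geodesic_regular Xgen vfG.
(* For the empty word [f], [Conj] is membership in the conjugacy closure; the automaton selects the
   geodesics. *)
rewrite KE; apply: (context_free_dfa (i := Conj _ [bseq]) (F := F)
  (q0 := q0) (delta := delta)) => w; last by move=> [_ /gen_complete]; apply.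
by rewrite /= word_val_nil mulg1 -geoE; split=> -[].
Qed.
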